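(* Let $G$ and $S$ be countable groups, let $\pi:G\to S$ be a group homomorphism, and let $H$ be a vdC set in $G$. If $e_S\notin\pi(H)$, where $e_S$ is the identity of $S$, then $\pi(H)$ is a vdC set in $S$.
   Context: A measure preserving system $(X,\mathcal{B},\mu,(T_g)_{g\in \Gamma})$, for a group $\Gamma$, is a probability space $(X,\mathcal{B},\mu)$ together with an action $(T_g)_{g\in \Gamma}$ of $\Gamma$ on $X$ by measure preserving maps (so $T_g\circ T_h=T_{gh}$). For a countable group $\Gamma$ with identity $e$, a set $H\subseteq \Gamma\setminus\{e\}$ is a vdC set in $\Gamma$ if for every measure preserving system $(X,\mathcal{B},\mu,(T_g)_{g\in \Gamma})$ and every (complex valued) $f\in L^\infty(\mu)$: if $\int_{X}f(T_hx)\overline{f(x)}\,d\mu(x)=0$ for all $h\in H$, then $\int_{X}f\,d\mu=0$. *)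

(* Defs.v *)
From HB Require Import structures.
From mathcomp Require Import all_boot all_order all_algebra.
From mathcomp Require Import complex.
From mathcomp Require Import all_classical all_reals all_analysis.

Set Implicit Arguments.
Unset Strict Implicit.
Unset Printing Implicit Defensive.

Import Order.TTheory GRing.Theory Num.Theory.
Import numFieldNormedType.Exports.

Local Open Scope classical_set_scope.
Local Open Scope ring_scope.

Section complex_valued.
Context {R : realType} {d : measure_display} {T : measurableType d}.

(* The Borel sigma-algebra of R[i] is that of R * R. *)
Definition cmeasurable_fun (f : T -> R[i]) : Prop :=
  measurable_fun [set: T] (fun x => complex.Re (f x)) /\
  measurable_fun [set: T] (fun x => complex.Im (f x)).

Definition cintegral (mu : {measure set T -> \bar R}) (f : T -> R[i]) : R[i] :=
  Complex (\int[mu]_x complex.Re (f x)) (\int[mu]_x complex.Im (f x)).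

(* Representatives of the elements of the complex L^oo(mu). *)
Definition Linfty (mu : {measure set T -> \bar R}) (f : T -> R[i]) : Prop :=
  cmeasurable_fun f /\
  finite_norm mu +oo%E (fun x => ComplexField.Normc.normc (f x)).

End complex_valued.

Definition is_action (G : groupType) (X : Type) (a : G -> X -> X) : Prop :=
  a 1%g = id /\ forall g h : G, a (g * h)%g = a g \o a h.

Definition measure_preserving (R : realType) (d : measure_display)
    (T : measurableType d) (mu : {measure set T -> \bar R}) (f : T -> T) : Prop :=
  measurable_fun [set: T] f /\
  forall A : set T, measurable A -> mu (f @^-1` A) = mu A.

Definition is_mps (R : realType) (G : groupType) (d : measure_display)
    (X : measurableType d) (mu : probability X R) (a : G -> X -> X) : Prop :=
  is_action a /\ forall g : G, measure_preserving mu (a g).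

Definition vdC_set (R : realType) (G : groupType) (H : set G) : Prop :=
  H `<=` [set~ 1%g] /\
  forall (d : measure_display) (X : measurableType d) (mu : probability X R)
      (a : G -> X -> X) (f : X -> R[i]),
    is_mps mu a -> Linfty mu f ->
    (forall h : G, H h ->
      cintegral mu (fun x => f (a h x) * conjc (f x)) = 0) ->
    cintegral mu f = 0.
Arguments vdC_set R {G} H.

(* Main.v *)
(* An action of S pulls back along pi to an action of G by the same
   measure-preserving maps, so the vdC property of H applies to it. *)
Require Import Defs.
From mathcomp Require Import all_boot all_order all_algebra.
From mathcomp Require Import all_classical all_reals all_analysis.

Local Open Scope classical_set_scope.

(** Pulling back leaves the space, [mu] and [f] unchanged, and the correlation of [f] at [h] becomes
    the original one at [pi h]. Vanishing over the image of [H] is thus vanishing over [H]. *)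

Lemma is_mps_comp (R : realType) (G S : groupType)
    (pi : {multiplicative G -> S}) (d : measure_display)
    (X : measurableType d) (mu : probability X R) (a : S -> X -> X) :
  is_mps mu a -> is_mps mu (fun g => a (pi g)).
Proof.
move=> [[a1 aM] a_mp]; split; last by move=> g; exact: a_mp.
(* Cancel [pi 1] in [pi 1 * pi 1 = pi 1 * 1]. *)
have pi1 : pi 1%g = 1%g by apply: (mulgI (pi 1%g)); rewrite -gmulfM !mulg1.
by split=> [|g h]; rewrite ?pi1 ?gmulfM ?a1 ?aM.
Qed.

Theorem proposition6p6 (R : realType) (G S : groupType)
    (countG : countable [set: G]) (countS : countable [set: S])
    (pi : {multiplicative G -> S}) (H : set G) :
  vdC_set R H -> ~ (pi @` H) 1%g -> vdC_set R (pi @` H).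
Proof.
move=> [_ vdCH] piH1; split=> [s piHs s1|d X mu a f a_mps f_Linfty f_orth].
  by apply: piH1; rewrite -s1.
apply: (vdCH _ _ mu (fun g => a (pi g))) => //; first exact: is_mps_comp.
(* The correlation to kill is that of [a] at [pi h], which lies in the image of [H]. *)
by move=> h Hh; apply: f_orth; exists h.
Qed.
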